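(* Let $(\mathcal X,\mathcal F,\mu)$ be a probability space and let $p,q\in\mathcal P$. The following statements are equivalent: (i) $q\in\mathcal M(p)$; (ii) $\mathcal M(p)=\mathcal M(q)$; (iii) $\frac{q}{p},\frac{p}{q}\in L^{\infty}$.
   Context: $(\mathcal X,\mathcal F,\mu)$ is a probability space; measurable functions are identified when equal $\mu$-a.s. $\mathcal P$ is the set of probability densities with respect to $\mu$ (i.e. $\int_{\mathcal X} p\,d\mu=1$) that are positive $\mu$-a.s. $L^\infty=L^\infty(\mu)$. Two densities $p,q\in\mathcal P$ are connected by an open mixture arc if there exists an open interval $I\supset[0,1]$ such that $(1-\theta)p+\theta q\in\mathcal P$ for every $\theta\in I$. $\mathcal M(p)$ denotes the set of all $q\in\mathcal P$ that are connected to $p$ by an open mixture arc. *)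

(* Defs.v *)
From HB Require Import structures.
From mathcomp Require Import all_boot all_order all_algebra.
From mathcomp Require Import all_classical all_reals all_analysis.
From mathcomp Require Import measurable_realfun.

Set Implicit Arguments.
Unset Strict Implicit.
Unset Printing Implicit Defensive.

Import Order.TTheory GRing.Theory Num.Theory.
Import numFieldNormedType.Exports.

Local Open Scope classical_set_scope.
Local Open Scope ring_scope.

(** Functions equal [mu]-a.e. are meant to be identified. Instead of passing to
    classes, we work with representatives [X -> R]: all the notions below are
    invariant under modification on a [mu]-negligible set (see
    [posdensity_ae_eq] and [mixture_component_ae_eq]), so an equality between
    the sets of representatives is the same as an equality between the sets of
    classes. *)

Definition posdensity d (X : measurableType d) (R : realType)
    (mu : probability X R) : set (X -> R) :=
  [set p : X -> R | [/\ measurable_fun setT p, {ae mu, forall x, 0 < p x}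
             & (\int[mu]_x (p x)%:E = 1)%E]].

Definition mixture (X : Type) (R : realType)
    (p q : X -> R) (t : R) : X -> R :=
  fun x => (1 - t) * p x + t * q x.

Definition open_mixture_arc d (X : measurableType d) (R : realType)
    (mu : probability X R) (p q : X -> R) : Prop :=
  exists I : set R, [/\ open I, is_interval I, `[0, 1]%classic `<=` I
    & forall t, I t -> posdensity mu (mixture p q t)].

Definition mixture_component d (X : measurableType d) (R : realType)
    (mu : probability X R) (p : X -> R) : set (X -> R) :=
  [set q : X -> R | posdensity mu q /\ open_mixture_arc mu p q].

Lemma posdensity_ae_eq d (X : measurableType d) (R : realType)
    (mu : probability X R) (p p' : X -> R) :
  measurable_fun setT p' -> {ae mu, forall x, p x = p' x} ->
  posdensity mu p -> posdensity mu p'.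
Proof.
move=> mp' pp' [mp p0 p1]; split=> //.
- by apply: filterS2 pp' p0 => x ->.
- rewrite -p1; apply: ae_eq_integral => //; [exact/measurable_EFinP..|].
  by apply: filterS pp' => x -> _.
Qed.

Lemma mixture_component_ae_eq d (X : measurableType d) (R : realType)
    (mu : probability X R) (p p' q q' : X -> R) :
  measurable_fun setT p' -> {ae mu, forall x, p x = p' x} ->
  measurable_fun setT q' -> {ae mu, forall x, q x = q' x} ->
  mixture_component mu p q -> mixture_component mu p' q'.
Proof.
move=> mp' pp' mq' qq' [dq [I [oI iI I01 arc]]]; split.
  exact: posdensity_ae_eq qq' dq.
exists I; split=> // t It; apply: posdensity_ae_eq (arc t It).
  by apply: measurable_funD; apply: measurable_funM.
by apply: filterS2 pp' qq' => x; rewrite /mixture => -> ->.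
Qed.

(* Main.v *)
(** All three statements express that [p] and [q] are comparable: for some
    [C > 0], both [q <= C p] and [p <= C q] hold a.e. Indeed [(1 - t) p + t q]
    is a.e. positive at [t = - e] and [t = 1 + e] when [p] and [q] are
    comparable with a constant smaller than [(1 + e) / e], and conversely
    forces comparability with this constant; the integral of a mixture is
    always 1. Comparability is an equivalence relation, so [p] and [q] are
    comparable iff their classes, the mixture components, coincide. *)

Require Import Defs.
From HB Require Import structures.
From mathcomp Require Import all_boot all_order all_algebra.
From mathcomp Require Import all_classical all_reals all_analysis.
From mathcomp Require Import measurable_realfun ess_sup_inf lra.

Set Implicit Arguments.
Unset Strict Implicit.
Unset Printing Implicit Defensive.

Import Order.TTheory GRing.Theory Num.Theory.
Import numFieldNormedType.Exports.

Local Open Scope classical_set_scope.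
Local Open Scope ring_scope.

(** Inversion is continuous off 0, an open set; the remaining point 0 is a measurable singleton. *)
Lemma measurable_invr (R : realType) :
  measurable_fun [set: R] (@GRing.inv R).
Proof.
rewrite -(setUv [set (0 : R)]); apply/measurable_funU => //.
  exact: measurableC.
split; first exact: measurable_fun_set1.
have neq0_open : open (~` [set (0 : R)]).
  exact/closed_openC/closed_eq.
apply: open_continuous_measurable_fun => // x.
by rewrite inE => /= /eqP /inv_continuous.
Qed.

Lemma measurable_fun_div d (X : measurableType d) (R : realType)
    (f g : X -> R) :
  measurable_fun setT f -> measurable_fun setT g ->
  measurable_fun setT (fun x => f x / g x).
Proof.
move=> mf mg; apply: measurable_funM => //.
exact: measurableT_comp (@measurable_invr R) mg.
Qed.

Lemma Lfun_inftyP d (X : measurableType d) (R : realType)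
    (mu : probability X R) (f : X -> R) :
  measurable_fun setT f ->
  f \in Lfun mu +oo%E <-> exists C, {ae mu, forall x, `|f x| <= C}.
Proof.
move=> mf.
(* The infinity norm is the essential supremum only when the total mass is positive; here that mass
   is 1. *)
have normE : ('N[mu]_+oo[EFin \o f] = ess_sup mu (abse \o (EFin \o f)))%E.
  by rewrite unlock /= probability_setT lte01.
split=> [/andP[_]|[C fC]].
  rewrite inE/= /finite_norm normE => fy.
  exists (fine (ess_sup mu (abse \o (EFin \o f)))).
  apply: filterS (ess_sup_ge mu (abse \o (EFin \o f))) => x /= fx.
  rewrite -lee_fin fineK// ge0_fin_numE//.
  by rewrite -normE Lnorm_ge0.
apply/andP; split; first by rewrite inE.
rewrite inE/= /finite_norm normE (@le_lt_trans _ _ C%:E) ?ltry//.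
by apply/ess_supP; apply: filterS fC => x fx /=; rewrite lee_fin.
Qed.

(** A.e. positivity gives [p] and its absolute value the same integral, 1. *)
Lemma posdensity_integrable d (X : measurableType d) (R : realType)
    (mu : probability X R) (p : X -> R) :
  posdensity mu p -> mu.-integrable setT (EFin \o p).
Proof.
move=> [mp p0 p1]; apply/integrableP; split; first exact/measurable_EFinP.
rewrite (@ae_eq_integral _ _ _ mu setT (EFin \o p)) ?p1 ?ltry//.
- by apply: measurableT_comp => //; exact/measurable_EFinP.
- exact/measurable_EFinP.
- by apply: filterS p0 => x p0 _ /=; rewrite gtr0_norm.
Qed.

Lemma integral_mixture d (X : measurableType d) (R : realType)
    (mu : probability X R) (p q : X -> R) (t : R) :
  posdensity mu p -> posdensity mu q ->
  (\int[mu]_x (mixture p q t x)%:E = 1)%E.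
Proof.
move=> dp dq; have [_ _ p1] := dp; have [_ _ q1] := dq.
have ip := posdensity_integrable dp; have iq := posdensity_integrable dq.
rewrite /mixture; under eq_integral do rewrite EFinD !EFinM.
rewrite integralD//; [|exact: integrableZl..].
by rewrite !integralZl// p1 q1 !mule1 -EFinD subrK.
Qed.

Lemma posdensity_mixture d (X : measurableType d) (R : realType)
    (mu : probability X R) (p q : X -> R) (t : R) :
  posdensity mu p -> posdensity mu q ->
  {ae mu, forall x, 0 < mixture p q t x} -> posdensity mu (mixture p q t).
Proof.
move=> dp dq pq0; split=> //; last exact: integral_mixture.
have [mp _ _] := dp; have [mq _ _] := dq.
by apply: measurable_funD; apply: measurable_funM.
Qed.

Definition ae_comparable d (X : measurableType d) (R : realType)
    (mu : probability X R) (p q : X -> R) : Prop :=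
  exists2 C, 0 < C & {ae mu, forall x, q x <= C * p x /\ p x <= C * q x}.

Lemma ae_comparable_refl d (X : measurableType d) (R : realType)
    (mu : probability X R) (p : X -> R) : ae_comparable mu p p.
Proof. by exists 1 => //; apply: nearW => x; rewrite mul1r. Qed.

Lemma ae_comparable_sym d (X : measurableType d) (R : realType)
    (mu : probability X R) (p q : X -> R) :
  ae_comparable mu p q -> ae_comparable mu q p.
Proof. by move=> [C C0 pq]; exists C => //; apply: filterS pq => x []. Qed.

Lemma ae_comparable_trans d (X : measurableType d) (R : realType)
    (mu : probability X R) (q p r : X -> R) :
  ae_comparable mu p q -> ae_comparable mu q r -> ae_comparable mu p r.
Proof.
move=> [C C0 pq] [D D0 qr]; exists (C * D); first exact: mulr_gt0.
apply: filterS2 pq qr => x [qCp pCq] [rDq qDr]; split.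
  by rewrite mulrAC (le_trans rDq)// mulrC ler_pM2r.
by rewrite -mulrA (le_trans pCq)// ler_pM2l.
Qed.

Lemma mixture_component_comparable d (X : measurableType d) (R : realType)
    (mu : probability X R) (p q : X -> R) :
  mixture_component mu p q -> ae_comparable mu p q.
Proof.
move=> [_ [I [oI _ I01 arc]]].
have I0 : I 0 by apply: I01; rewrite /= in_itv/= lexx ler01.
have I1 : I 1 by apply: I01; rewrite /= in_itv/= lexx ler01.
(* Openness of [I] at 0 and at 1 leaves room for a common [e] beyond both ends. *)
have [e [e0 Ie I1e]] : exists e : R, [/\ 0 < e, I (- e) & I (1 + e)].
  near (0 : R)^'+ => e.
  have e0 : 0 < e by [].
  exists e; split => //.
    have : `[0 - e, 0 + e] `<=` I by near: e; exact: open_itvcc_subset.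
    by apply; rewrite /= in_itv/=; lra.
  have : `[1 - e, 1 + e] `<=` I by near: e; exact: open_itvcc_subset.
  by apply; rewrite /= in_itv/=; lra.
have [_ mixN _] := arc _ Ie; have [_ mix1 _] := arc _ I1e.
(* Positivity at [- e] reads [e * q x < (1 + e) * p x]; at [1 + e] the roles of [p] and [q] are
   exchanged. *)
exists ((1 + e) / e); first by rewrite divr_gt0// addr_gt0.
apply: filterS2 mixN mix1 => x; rewrite /mixture => Nx x1.
by split; rewrite mulrAC ler_pdivlMr//; lra.
Unshelve. all: by end_near. Qed.

(** For [t < 0] the negative term is absorbed: [- t * b <= - t * C * a < a < (1 - t) * a]. The case
    [1 < t] is symmetric, with [(t - 1) * a < b < t * b]; in between, the combination is convex. *)
Lemma mixture_gt0 (R : realFieldType) (C a b t : R) :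
  0 < C -> 0 < a -> 0 < b -> b <= C * a -> a <= C * b ->
  - C^-1 < t < 1 + C^-1 -> 0 < (1 - t) * a + t * b.
Proof.
move=> C0 a0 b0 bCa aCb /andP[].
rewrite -ltrBlDl !(ltrNl _ t) => Nt t1.
have {}Nt : - t * C < 1 by rewrite -ltr_pdivlMr// mul1r.
have {}t1 : (t - 1) * C < 1 by rewrite -ltr_pdivlMr// mul1r.
have [t0|t0] := ltP t 0.
  have : - t * b <= - t * (C * a) by rewrite ler_wpM2l// oppr_ge0 ltW.
  have : - t * C * a < 1 * a by rewrite ltr_pM2r.
  nra.
have [t1'|t1'] := ltP 1 t.
  have : (t - 1) * a <= (t - 1) * (C * b) by rewrite ler_wpM2l// subr_ge0 ltW.
  have : (t - 1) * C * b < 1 * b by rewrite ltr_pM2r.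
  nra.
nra.
Qed.

Lemma comparable_mixture_component d (X : measurableType d) (R : realType)
    (mu : probability X R) (p q : X -> R) :
  posdensity mu p -> posdensity mu q ->
  ae_comparable mu p q -> mixture_component mu p q.
Proof.
move=> dp dq [C C0 pq]; split=> //.
have [[_ p0 _] [_ q0 _]] := (dp, dq).
have V0 : 0 < C^-1 by rewrite invr_gt0.
(* The margin [C^-1] is the one for which [mixture_gt0] yields positivity at almost every point. *)
exists `]- C^-1, 1 + C^-1[%classic; split.
- exact: interval_open.
- exact: interval_is_interval.
- by move=> t; rewrite /= !in_itv/= => ?; lra.
- move=> t; rewrite /= in_itv/= => It; apply: posdensity_mixture => //.
  apply: filterS3 p0 q0 pq => x p0 q0 [qCp pCq].
  exact: mixture_gt0 It.
Qed.

Lemma mixture_componentP d (X : measurableType d) (R : realType)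
    (mu : probability X R) (p q : X -> R) :
  posdensity mu p ->
  mixture_component mu p q <-> posdensity mu q /\ ae_comparable mu p q.
Proof.
move=> dp; split=> [pq|[dq pq]].
  by split; [case: pq|exact: mixture_component_comparable].
exact: comparable_mixture_component.
Qed.

Lemma ae_comparable_LfunP d (X : measurableType d) (R : realType)
    (mu : probability X R) (p q : X -> R) :
  posdensity mu p -> posdensity mu q ->
  ae_comparable mu p q <->
  ((fun x => q x / p x) \in Lfun mu +oo%E) /\
  ((fun x => p x / q x) \in Lfun mu +oo%E).
Proof.
move=> [mp p0 _] [mq q0 _].
split=> [[C C0 pq]|[/Lfun_inftyP qp /Lfun_inftyP pq]].
  (* Both ratios are a.e. positive, so the comparability constant bounds their absolute values. *)
  split; apply/Lfun_inftyP; do ?exact: measurable_fun_div; exists C;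
    apply: filterS3 p0 q0 pq => x {}p0 {}q0 [qCp pCq];
    by rewrite gtr0_norm ?divr_gt0// ler_pdivrMr.
have [C qpC] := qp (measurable_fun_div mq mp).
have [D pqD] := pq (measurable_fun_div mp mq).
(* One constant must dominate both bounds, whose signs are unknown, and be positive. *)
exists (`|C| + `|D| + 1); first by rewrite ltr_wpDl// addr_ge0.
apply: filterS2 (filterI p0 q0) (filterI qpC pqD) => x [{}p0 {}q0] [].
move=> /(le_trans (ler_norm _)) xC /(le_trans (ler_norm _)) xD.
have := ler_norm C; have := ler_norm D.
have := normr_ge0 C; have := normr_ge0 D.
by split; rewrite -ler_pdivrMr//; lra.
Qed.

Theorem theorem4p11 (d : measure_display) (X : measurableType d)
    (R : realType) (mu : probability X R) (p q : X -> R)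
    (hp : posdensity mu p) (hq : posdensity mu q) :
  [<-> mixture_component mu p q;
       mixture_component mu p = mixture_component mu q;
       ((fun x => q x / p x) \in Lfun mu +oo%E) /\
       ((fun x => p x / q x) \in Lfun mu +oo%E)].
Proof.
have Mp r := mixture_componentP r hp.
have Mq r := mixture_componentP r hq.
tfae.
(* Symmetry and transitivity make the comparability classes of [p] and [q] equal. *)
- move=> /Mp[_ pq]; apply/seteqP; split=> r.
    move=> /Mp[dr pr]; apply/Mq.
    by split=> //; exact: ae_comparable_trans (ae_comparable_sym pq) pr.
  move=> /Mq[dr qr]; apply/Mp.
  by split=> //; exact: ae_comparable_trans pq qr.
(* By reflexivity [q] lies in its own component, hence in that of [p]. *)
- move=> MpMq; apply/ae_comparable_LfunP => //.
  apply: mixture_component_comparable; rewrite MpMq.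
  by apply: comparable_mixture_component => //; exact: ae_comparable_refl.
- move=> /(ae_comparable_LfunP hp hq); exact: comparable_mixture_component.
Qed.
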